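(* Let $\mathbb K$ be a field, $\mathbb P=\mathbb K[x_1,\dots,x_n]$, and let $f=(f_1,\dots,f_d)\in\mathbb P^d$ be the initial polynomials. When a regular TRB algorithm with input $f$ terminates, the polynomials $v$ of the pairs $(u,v)\in DONE$ form a Gröbner basis (with respect to $\prec_m$) of the ideal $\langle f_1,\dots,f_d\rangle$.
   Context: Basic notions. $M$ is the set of monomials of $\mathbb P$; a monomial of $\mathbb P^d$ is $mE_i$ with $m\in M$ and $E_i$ the $i$-th unit vector; $s\mid s'$ for monomials of $\mathbb P^d$ means $s'=ms$ for some $m\in M$. $\prec_m$, $\prec_s$ are admissible orders on $\mathbb P$, $\mathbb P^d$ (total orders on monomials compatible with multiplication by $M$, with $1\prec_m m$ for $1\ne m\in M$, resp. $s\prec_s ms$). Conventionally $lm(0)=0$ and $0$ is smaller than every monomial. Leading monomials/terms/coefficients are taken with respect to $\prec_m$ on $\mathbb P$ and $\prec_s$ on $\mathbb P^d$. A pair is $p=(u,v)\in\mathbb P^d\times\mathbb P$ with $u\cdot f=v$; $lm(p)=lm(v)$, $lt(p)=lt(v)$, $sig(p)=lm(u)$. $(u_1,v_1)\prec_p(u_2,v_2)$ iff $lm(v_1)lm(u_2)\prec_s lm(v_2)lm(u_1)$. $p_1\equiv p_2$ (equivalent) iff $sig(p_1)=sig(p_2)$ and $lm(p_1)=lm(p_2)$. $p_1\sim p_2$ (similar) iff $lm(p_1)sig(p_2)=lm(p_2)sig(p_1)$. $p$ is syzygy if $lm(p)=0$. $p_1$ is top reducible by $p_2$ if both are non-syzygy,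 $p_1\prec_p p_2$ and $lm(p_2)\mid lm(p_1)$; the top reduction replaces $p_1$ by $p_1-\frac{lt(p_1)}{lt(p_2)}p_2$. A non-syzygy pair that cannot be top reduced by any pair is a TRP pair. The TRP similar set of $p$ is the set of all TRP pairs similar to $p$. A TRB pair is a TRP pair $p'$ such that $sig(p')$ is not properly divisible by any signature of a pair in the same TRP similar set. Multiplied pairs. A multiplied pair $[m,p]$ is an element of $M\times PAIR$ ($PAIR$ the set of all pairs); its value is $mp$ and $sig([m,p])=sig(mp)$. For two non-similar non-syzygy pairs $p_1,p_2$, their J-pair is $[m,p]$ with $p$ the $\prec_p$-smaller of $p_1,p_2$ and $m=lcm(lm(p_1),lm(p_2))/lm(p)$. TRB algorithm. Input $f$. Step 0: $DONE:=\emptyset$, $TODO:=\{[1,(E_i,f_i)]: i=1,\dots,d\}$ (the initial multiplied pairs). Step 1: if $TODO=\emptyset$ output $DONE$; otherwise select (and remove from $TODO$) a multiplied pair $[m,p]$ with smallest signature with respect to $\prec_s$. Step 2: if $Criterions([m,p])$ is true (some criterion is met), go to Step 1; otherwise put $p':=Reductions(mp)$, where $Reductions$ is a composition of top reductions whose output must be top irreducible by any pair. Step 3: if $CheckStore(p')$ is true, add to $TODO$ all J-pairs of $p'$ with $p''\in DONE$ (none if the two pairs are similar or one is syzygy), and then add $p'$ to $DONE$; go to Step 1. $CheckStore$ blocks (returns false on) $p'$ if $p'$ is non-initial and equivalent to the input $mp$ of the corresponding $Reductions$. Particular TRB algorithms are obtained by specifying $Criterions$, $Reductions$, $CheckStore$.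 A TRB algorithm is regular if for every $f$, when the algorithm terminates, every TRB pair is, up to equivalence, in $DONE$. *)

(* Defs.v *)
From mathcomp Require Import all_boot all_order all_algebra finmap.
From mathcomp Require Import mpoly.

Set Implicit Arguments.
Unset Strict Implicit.
Unset Printing Implicit Defensive.

Import GRing.Theory.
Local Open Scope ring_scope.
Local Open Scope fset_scope.

(* Monomials of P = K[x_1..x_n] are multinomials ['X_{1..n}], written
   additively; a monomial m E_i of P^d is the couple (m, i).  A quantity that
   is a monomial or 0 lives in an [option] type, [None] standing for 0. *)
Notation smon n d := ('X_{1..n} * 'I_d)%type.

Definition smul n d (m : 'X_{1..n}) (s : smon n d) : smon n d :=
  ((m + s.1)%MM, s.2).

Definition strict_total (T : eqType) (lt : rel T) : Prop :=
  [/\ irreflexive lt, transitive lt & forall x y, x != y -> lt x y || lt y x].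

Definition admissible_mon n (ltm : rel 'X_{1..n}) : Prop :=
  [/\ strict_total ltm,
      forall m a b, ltm a b -> ltm (m + a)%MM (m + b)%MM &
      forall m, m != 0%MM -> ltm 0%MM m].

Definition admissible_smon n d (lts : rel (smon n d)) : Prop :=
  [/\ strict_total lts,
      forall m a b, lts a b -> lts (smul m a) (smul m b) &
      forall m s, m != 0%MM -> lts s (smul m s)].

Definition olt (T : Type) (lt : rel T) : rel (option T) := fun x y =>
  match x, y with
  | None, Some _ => true
  | Some a, Some b => lt a b
  | _, None => false
  end.

Definition omax (T : Type) (lt : rel T) (x y : option T) : option T :=
  if olt lt x y then y else x.

(* Product of a monomial-or-0 of P with a monomial-or-0 of P^d. *)
Definition omul n d (a : option 'X_{1..n}) (s : option (smon n d)) :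
    option (smon n d) :=
  match a, s with Some m, Some t => Some (smul m t) | _, _ => None end.

Definition sdvd n d (s s' : option (smon n d)) : Prop :=
  exists m : 'X_{1..n}, s' = omul (Some m) s.

Definition ideal_gen (R : comNzRingType) (S : R -> Prop) (h : R) : Prop :=
  exists s : seq (R * R),
    (forall x, x \in s -> S x.2) /\ h = \sum_(x <- s) x.1 * x.2.

Section LeadingMonomials.
Variables (K : fieldType) (n d : nat).
Variables (ltm : rel 'X_{1..n}) (lts : rel (smon n d)).

Definition lm (v : {mpoly K[n]}) : option 'X_{1..n} :=
  \big[omax ltm/None]_(m <- msupp v) Some m.

Definition slm (u : 'rV[{mpoly K[n]}]_d) : option (smon n d) :=
  \big[omax lts/None]_(i < d) \big[omax lts/None]_(m <- msupp (u 0 i))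
    Some (m, i).

(* Equal to [lm v] when v != 0; the junk value at 0 is harmless in [lc]
   and [lterm], which both vanish at 0. *)
Definition lmon (v : {mpoly K[n]}) : 'X_{1..n} := odflt 0%MM (lm v).

Definition lc (v : {mpoly K[n]}) : K := v@_(lmon v).
Definition lterm (v : {mpoly K[n]}) : {mpoly K[n]} := lc v *: 'X_[lmon v].

Definition groebner_basis (G : {fset {mpoly K[n]}}) (I : {mpoly K[n]} -> Prop) :
    Prop :=
  (forall g, g \in G -> I g) /\
  (forall h, ideal_gen (fun t => exists2 g, g \in G & t = lterm g) h <->
             ideal_gen (fun t => exists2 g, I g & t = lterm g) h).

End LeadingMonomials.

(* Ambient type of pairs (u, v); being a pair for f is [is_pair f]. *)
Notation ppair K n d := ('rV[{mpoly K[n]}]_d * {mpoly K[n]})%type.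

(* A multiplied pair [m, p] is the couple (m, p). *)
Notation mpair K n d := ('X_{1..n} * ppair K n d)%type.

Section Pairs.
Variables (K : fieldType) (n d : nat).
Variables (ltm : rel 'X_{1..n}) (lts : rel (smon n d)).
Implicit Types (f : 'rV[{mpoly K[n]}]_d) (p q : ppair K n d).
Implicit Types (w : mpair K n d).

Definition is_pair f p : Prop := \sum_(i < d) p.1 0 i * f 0 i = p.2.

Definition plm p : option 'X_{1..n} := lm ltm p.2.
Definition sig p : option (smon n d) := slm lts p.1.
Definition syzygy p : bool := plm p == None.

Definition ltp p q : bool :=
  olt lts (omul (plm p) (sig q)) (omul (plm q) (sig p)).
Definition equivalent p q : bool := (sig p == sig q) && (plm p == plm q).
Definition similar p q : bool := omul (plm p) (sig q) == omul (plm q) (sig p).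

Definition top_reducible p q : bool :=
  [&& ~~ syzygy p, ~~ syzygy q, ltp p q & (lmon ltm q.2 <= lmon ltm p.2)%MM].

Definition top_reduce p q : ppair K n d :=
  let t := (lc ltm p.2 / lc ltm q.2) *: 'X_[lmon ltm p.2 - lmon ltm q.2] in
  (p.1 - t *: q.1, p.2 - t * q.2).

Definition top_irreducible f p : Prop :=
  forall q, is_pair f q -> ~~ top_reducible p q.

Inductive top_reduces f p : ppair K n d -> Prop :=
| top_reduces_refl : top_reduces f p p
| top_reduces_step p' q : top_reduces f p p' -> is_pair f q ->
    top_reducible p' q -> top_reduces f p (top_reduce p' q).

Definition TRP f p : Prop :=
  [/\ is_pair f p, ~~ syzygy p & top_irreducible f p].

Definition TRP_similar_set f p q : Prop := TRP f q /\ similar q p.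

Definition TRB f p : Prop :=
  TRP f p /\
  forall q, TRP_similar_set f p q -> ~ (sdvd (sig q) (sig p) /\ sig q <> sig p).

Definition mval w : ppair K n d := ('X_[w.1] *: w.2.1, 'X_[w.1] * w.2.2).
Definition msig w : option (smon n d) := sig (mval w).

Definition jpair p q : mpair K n d :=
  let l := mlcm (lmon ltm p.2) (lmon ltm q.2) in
  if ltp p q then ((l - lmon ltm p.2)%MM, p) else ((l - lmon ltm q.2)%MM, q).

Definition jpairs p (D : {fset ppair K n d}) : {fset mpair K n d} :=
  [fset jpair p q | q in D &
     [&& ~~ syzygy p, ~~ syzygy q & ~~ similar p q]].

Definition initial_pair f (i : 'I_d) : ppair K n d := (delta_mx 0 i, f 0 i).
Definition initial f p : Prop := exists i, p = initial_pair f i.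

End Pairs.

(* Besides TODO and DONE, a state records the multiplied pairs already treated,
   latest first, each with its reduction ([None] if a criterion discarded it).
   The log determines the whole run so far, so that Criterions, Reductions and
   CheckStore may depend on anything the algorithm has met. *)
Record state (K : fieldType) (n d : nat) := State {
  todo : {fset mpair K n d};
  done : {fset ppair K n d};
  log : seq (mpair K n d * option (ppair K n d)) }.

(* The state argument is the one reached after removing from TODO the
   multiplied pair under treatment, which is the next argument; the last
   argument of [check_store] is the output of [reductions]. *)
Record algorithm (K : fieldType) (n d : nat) := Algorithm {
  criterions : 'rV[{mpoly K[n]}]_d -> state K n d -> mpair K n d -> bool;
  reductions : 'rV[{mpoly K[n]}]_d -> state K n d -> mpair K n d -> ppair K n d;
  check_store : 'rV[{mpoly K[n]}]_d -> state K n d -> mpair K n d ->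
                ppair K n d -> bool }.

Section Run.
Variables (K : fieldType) (n d : nat).
Variables (ltm : rel 'X_{1..n}) (lts : rel (smon n d)).
Variable A : algorithm K n d.
Implicit Types (f : 'rV[{mpoly K[n]}]_d) (st : state K n d) (w : mpair K n d).

Definition init_state f : state K n d :=
  State [fset ((0%MM, initial_pair f i) : mpair K n d) | i in 'I_d] fset0 [::].

Definition selectable st w : Prop :=
  w \in todo st /\
  forall w', w' \in todo st -> ~~ olt lts (msig lts w') (msig lts w).

Definition remove st w : state K n d := State (todo st `\ w) (done st) (log st).

Definition process f st w : state K n d :=
  let st1 := remove st w in
  if criterions A f st1 w then
    State (todo st1) (done st1) ((w, None) :: log st1)
  else
    let p' := reductions A f st1 w in
    if check_store A f st1 w p' then
      State (todo st1 `|` jpairs ltm lts p' (done st1)) (p' |` done st1)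
            ((w, Some p') :: log st1)
    else State (todo st1) (done st1) ((w, Some p') :: log st1).

Inductive reachable f : state K n d -> Prop :=
| reachable_init : reachable f (init_state f)
| reachable_next st w :
    reachable f st -> selectable st w -> reachable f (process f st w).

Definition terminates_in f st : Prop := reachable f st /\ todo st = fset0.

(* The requirements on Reductions and CheckStore bear on the calls that
   actually occur in some run. *)
Definition TRB_algorithm : Prop :=
  forall f st w, reachable f st -> selectable st w ->
  let st1 := remove st w in
  ~~ criterions A f st1 w ->
  let p' := reductions A f st1 w in
  [/\ top_reduces ltm lts f (mval w) p',
      top_irreducible ltm lts f p' &
      ~ initial f p' -> equivalent ltm lts p' (mval w) ->
      check_store A f st1 w p' = false].

Definition regular : Prop :=
  forall f st, terminates_in f st ->
  forall p, TRB ltm lts f p ->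
  exists2 q, q \in done st & equivalent ltm lts p q.

End Run.

(* Main.v *)
(* Let h be a nonzero element of the ideal.  Among the pairs with leading
   monomial lm h, one of minimal signature is top irreducible: a top reducer,
   multiplied by a monomial, would give a pair with the same leading monomial
   and a smaller signature.  If a TRP pair is not TRB, a similar TRP pair whose
   signature properly divides its own has, by similarity, a leading monomial
   that properly divides its own; descending on the degree yields a TRB pair
   whose leading monomial divides lm h, and regularity puts an equivalent pair
   in DONE.  Minimal signatures exist by Dickson's lemma. *)
Require Import Defs.
From mathcomp Require Import all_boot all_order all_algebra finmap.
From mathcomp Require Import mpoly.
From Stdlib Require Import Classical_Prop.

Local Open Scope ring_scope.
Local Open Scope fset_scope.
Set Implicit Arguments.
Unset Strict Implicit.
Unset Printing Implicit Defensive.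

Import GRing.Theory.

(** * Dickson's lemma, for finitely many functions to the natural numbers *)

Lemma dickson (T : eqType) (fs : seq (T -> nat)) (P : T -> Prop) :
  exists s : seq T, (forall x, x \in s -> P x) /\
    forall y, P y -> exists2 x, x \in s & all (fun g => g x <= g y)%N fs.
Proof.
elim: fs P => [|g fs IHfs] P.
  (* With nothing to compare, any one element of [P] dominates, and an empty [P] needs none. *)
  have [[x Px]|noP] := classic (exists x, P x).
    exists [:: x]; split=> [z|y _]; first by rewrite inE => /eqP->.
    by exists x; rewrite ?mem_head.
  by exists [::]; split=> // y Py; case: noP; exists y.
have [s [sP sB]] := IHfs P.
(* [s] already dominates every [y] with [g y >= N]. Below [N], each of the finitely many level sets
   of [g] gets its own list from the induction hypothesis. *)
pose N := \max_(x <- s) g x.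
have gN x : x \in s -> (g x <= N)%N by move=> xs; apply: leq_bigmax_seq.
have [s' [s'P s'B]] : exists s' : seq T, (forall x, x \in s' -> P x) /\
    forall y, P y -> (g y < N)%N ->
      exists2 x, x \in s' & all (fun h => h x <= h y)%N (g :: fs).
  elim: N {gN} => [|N [r [rP rB]]]; first by exists [::].
  have [r' [r'P r'B]] := IHfs (fun x => P x /\ g x = N).
  exists (r ++ r'); split=> [x|y Py].
    by rewrite mem_cat => /orP[/rP|/r'P[]].
  rewrite ltnS leq_eqVlt => /orP[/eqP gy|/(rB _ Py)[x xr xy]].
    have [x xr' xy] := r'B y (conj Py gy).
    by exists x; rewrite ?mem_cat ?xr' ?orbT //= xy (r'P x xr').2 gy leqnn.
  by exists x; rewrite ?mem_cat ?xr.
exists (s ++ s'); split=> [x|y Py]; first by rewrite mem_cat => /orP[/sP|/s'P].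
have [gy|gy] := ltnP (g y) N.
  by have [x xs' xy] := s'B y Py gy; exists x; rewrite ?mem_cat ?xs' ?orbT.
have [x xs xy] := sB y Py; exists x; first by rewrite mem_cat xs.
by rewrite /= xy (leq_trans (gN x xs) gy).
Qed.

(** * Maxima of possibly empty sets in a strict total order *)

Section StrictTotal.
Variables (T : eqType) (lt : rel T).
Hypothesis lt_total : strict_total lt.

Let ltxx : irreflexive lt. Proof. by case: lt_total. Qed.
Let lt_trans : transitive lt. Proof. by case: lt_total. Qed.
Let lt_or x y : x != y -> lt x y || lt y x.
Proof. by case: lt_total => _ _; apply. Qed.

Lemma strict_total_asym x y : lt x y -> lt y x = false.
Proof. by move=> xy; apply/negP=> /(lt_trans xy); rewrite ltxx. Qed.

Lemma seq_has_min (s : seq T) x0 : x0 \in s ->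
  exists2 x, x \in s & forall y, y \in s -> ~~ lt y x.
Proof.
elim: s x0 => // a [|b s] IHs x0 _.
  by exists a; rewrite ?mem_head // => y; rewrite inE => /eqP->; rewrite ltxx.
have [x xs xmin] := IHs b (mem_head _ _).
have [ax|nax] := boolP (lt a x).
  exists a; rewrite ?mem_head // => y; rewrite inE => /orP[/eqP->|/xmin].
    by rewrite ltxx.
  by apply: contraNN => /lt_trans; apply.
exists x; first by rewrite inE xs orbT.
by move=> y; rewrite inE => /orP[/eqP->|/xmin].
Qed.

(** Specification of the folds by [omax]. Its uniqueness turns identities between leading monomials
    into statements about supports. *)
Definition is_max (S : T -> Prop) (o : option T) : Prop :=
  if o is Some x then S x /\ forall y, S y -> y != x -> lt y x
  else forall y, ~ S y.

Lemma is_max_unique S o o' : is_max S o -> is_max S o' -> o = o'.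
Proof.
case: o o' => [x|] [x'|] //=; last by move=> h [/h].
  move=> [Sx xM] [Sx' x'M]; case: (eqVneq x x') => [->//|ne].
  have := x'M _ Sx ne; rewrite (strict_total_asym (xM _ Sx' _)) //.
  by rewrite eq_sym.
by move=> [Sx _] /(_ x).
Qed.

Lemma eq_is_max S S' o : (forall x, S x <-> S' x) -> is_max S o -> is_max S' o.
Proof.
by case: o => [x|] SS' /=; [case=> /SS' Sx xM; split=> // y /SS'/xM|
  move=> xM y /SS'/xM].
Qed.

Lemma is_max_omax S S' o o' : is_max S o -> is_max S' o' ->
  is_max (fun x => S x \/ S' x) (omax lt o o').
Proof.
rewrite /omax; case: o o' => [x|] [x'|] //=; last 2 first.
- by move=> h [Sx xM]; split; [right|move=> y [/h|/xM]].
- by move=> h h' y [/h|/h'].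
- move=> [Sx xM] [Sx' x'M]; case: ifP => xx'; split; auto.
    move=> y [Sy|/x'M] // _; case: (eqVneq y x) => [->//|/(xM _ Sy)].
    by move=> /lt_trans; apply.
  move=> y [/xM//|Sy] yx; have [yx'|ne] := eqVneq y x'.
    by move: (lt_or yx); rewrite yx' xx' orbF.
  have [xE|/lt_or] := eqVneq x x'; first by rewrite xE x'M.
  by rewrite xx' /=; apply: lt_trans; apply: x'M.
by move=> [Sx xM] h; split; [left|move=> y [/xM|/h]].
Qed.

Lemma is_max_big (I : eqType) (r : seq I) (S : I -> T -> Prop) F :
  (forall i, is_max (S i) (F i)) ->
  is_max (fun x => exists2 i, i \in r & S i x) (\big[omax lt/None]_(i <- r) F i).
Proof.
move=> SF; elim: r => [|a r IHr]; first by rewrite big_nil => y [].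
have := is_max_omax (SF a) IHr; rewrite big_cons.
case: (omax _ _ _) => [x [Sx xM]|xM]; last first.
  move=> y [i]; rewrite inE => /orP[/eqP->|ir] Sy; apply: (xM y); first by left.
  by right; exists i.
split.
  case: Sx => [Sx|[i ir Sx]]; first by exists a; rewrite ?mem_head.
  by exists i; rewrite // inE ir orbT.
move=> y [i]; rewrite inE => /orP[/eqP->|ir] Sy; apply: xM; first by left.
by right; exists i.
Qed.

(** Meant for multiplication by a monomial, which preserves both admissible orders strictly. *)
Lemma is_max_omap (S S' : T -> Prop) (g : T -> T) o :
  (forall x y, lt x y -> lt (g x) (g y)) ->
  (forall y, S' y <-> exists2 x, S x & y = g x) ->
  is_max S o -> is_max S' (omap g o).
Proof.
move=> g_mono SS'; case: o => [x [Sx xM]|xM] /=; last by move=> y /SS'[z /xM].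
split=> [|y /SS'[z Sz ->] ne]; first by apply/SS'; exists x.
by apply/g_mono/xM => //; apply: contraNneq ne => ->.
Qed.

End StrictTotal.

(** * Admissible orders: cancellation and minimal elements *)

Section AdmissibleOrders.
Variables (n d : nat) (ltm : rel 'X_{1..n}) (lts : rel (smon n d)).
Hypothesis ltm_adm : admissible_mon ltm.
Hypothesis lts_adm : admissible_smon lts.

Let ltm_total : strict_total ltm. Proof. by case: ltm_adm. Qed.
Let lts_total : strict_total lts. Proof. by case: lts_adm. Qed.
Let ltm_add m a b : ltm a b -> ltm (m + a)%MM (m + b)%MM.
Proof. by case: ltm_adm => _ h _; apply: h. Qed.
Let lts_smul m a b : lts a b -> lts (smul m a) (smul m b).
Proof. by case: lts_adm => _ h _; apply: h. Qed.

Lemma smulA m m' (s : smon n d) : smul m (smul m' s) = smul (m + m')%MM s.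
Proof. by rewrite /smul /= addmA. Qed.

Lemma smul_cancel m a b : lts (smul m a) (smul m b) -> lts a b.
Proof.
move=> ab; have [eab|] := eqVneq a b.
  by move: ab; rewrite eab; case: lts_total => ->.
case: (lts_total) => _ _ /[apply] /orP[//|/lts_smul ba].
by move: ab; rewrite (strict_total_asym lts_total (ba m)).
Qed.

(** By Dickson's lemma, all of [P] consists of multiples of finitely many of its elements. The least
    of these is minimal in [P], as a multiple is never smaller than what it multiplies. *)
Lemma admissible_has_min (P : smon n d -> Prop) s0 : P s0 ->
  exists2 s, P s & forall s', P s' -> ~~ lts s' s.
Proof.
move=> Ps0.
(* The first two functions together force equality of the unit vectors. *)
pose fs : seq (smon n d -> nat) := [:: (fun s : smon n d => s.2 : nat),
  (fun s : smon n d => d - s.2)%N &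
  [seq (fun s : smon n d => s.1 i) | i <- enum 'I_n]].
have [r [rP rB]] := dickson fs P.
have [x0 x0r _] := rB _ Ps0.
have [s sr smin] := seq_has_min lts_total x0r.
exists s; first exact: rP.
move=> s' Ps'; have [x xr /= /and3P[le1 le2 le3]] := rB _ Ps'.
have xs' : s' = smul (s'.1 - x.1)%MM x.
  rewrite /smul submK; last first.
    apply/mnm_lepP => i; move: le3; rewrite all_map => /allP/(_ i) /=; apply.
    by rewrite mem_enum.
  case: s' le1 le2 {Ps' le3} => a i /= le1 le2; congr pair; apply: val_inj.
  apply/eqP; rewrite eqn_leq le1 andbT.
  by have := leq_sub2l d le2; rewrite !subKn ?(ltnW (ltn_ord _)).
(* Since [s'] is a multiple of [x], having [s'] below [s] would put [x] below [s], the least element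
   of [r]. *)
apply/negP => lt_s's; apply: (negP (smin x xr)).
have [e0|ne0] := eqVneq (s'.1 - x.1)%MM 0%MM.
  by move: xs'; rewrite e0 /smul add0m -surjective_pairing => <-.
case: (lts_total) => _ tr _; apply: tr lt_s's.
by rewrite xs'; case: lts_adm => _ _; apply.
Qed.

(** * Leading monomials and signatures under monomial multiplication *)

Section Leading.
Variable K : fieldType.
Implicit Types (v : {mpoly K[n]}) (u f : 'rV[{mpoly K[n]}]_d).
Implicit Types (p q : ppair K n d).

Lemma lmP v : is_max ltm (fun m => m \in msupp v) (lm ltm v).
Proof.
apply: (eq_is_max _ (@is_max_big _ _ ltm_total _ _ (fun i x => x = i) _ _)).
  by move=> x; split=> [[i iv ->] //|xv]; exists x.
by move=> i; split=> // y ->; rewrite eqxx.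
Qed.

Lemma slmP u : is_max lts (fun s => s.1 \in msupp (u 0 s.2)) (slm lts u).
Proof.
pose S (i : 'I_d) (s : smon n d) :=
  exists2 m, m \in msupp (u 0 i) & s = (m, i).
apply: (eq_is_max _ (@is_max_big _ _ lts_total _ _ S _ _)).
  move=> [m i] /=; split=> [[j _ [m' m'u [-> ->]]] //|mu].
  by exists i; [rewrite mem_index_enum|exists m].
move=> i; apply: (@is_max_big _ _ lts_total _ _ (fun m s => s = (m, i))) => m.
by split=> // y ->; rewrite eqxx.
Qed.

Lemma mem_msuppXM t v y :
  y \in msupp ('X_[t] * v) <-> exists2 m, m \in msupp v & y = (t + m)%MM.
Proof.
by rewrite mulrC (perm_mem (msuppMX v t)); split=> [/mapP|h]; last apply/mapP.
Qed.

Lemma lmXM t v : lm ltm ('X_[t] * v) = omap (mnm_add t) (lm ltm v).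
Proof.
apply: (is_max_unique ltm_total (lmP _)).
by apply: (is_max_omap _ (@mem_msuppXM t v) (lmP v)) => x y; apply: ltm_add.
Qed.

Lemma slmXM t u : slm lts ('X_[t] *: u) = omul (Some t) (slm lts u).
Proof.
apply: (is_max_unique lts_total (slmP _)).
rewrite (_ : omul _ _ = omap (smul t) (slm lts u)); last by case: slm.
apply: (is_max_omap (@lts_smul t) _ (slmP u)) => -[y i] /=.
rewrite mxE; split=> [/mem_msuppXM[m mu ->]|[[m j] /= mu [-> ->]]].
  by exists (m, i).
by apply/mem_msuppXM; exists m.
Qed.

Lemma lm_eqNone v : (lm ltm v == None) = (v == 0).
Proof.
apply/eqP/eqP => [v0|->]; last by rewrite /lm msupp0 big_nil.
apply/eqP; rewrite -msupp_eq0; have := lmP v; rewrite v0 /=.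
by case: msupp => // m s /(_ m); rewrite mem_head => /(_ isT).
Qed.

Lemma lm_lmon v : v != 0 -> lm ltm v = Some (lmon ltm v).
Proof. by rewrite -lm_eqNone /lmon; case: lm. Qed.

Lemma lc_neq0 v : v != 0 -> lc ltm v != 0.
Proof.
move=> /lm_lmon vE; have := lmP v; rewrite vE /= => -[vs _].
by rewrite /lc -mcoeff_msupp.
Qed.

Lemma lterm0 : lterm ltm (0 : {mpoly K[n]}) = 0.
Proof. by rewrite /lterm /lc mcoeff0 scale0r. Qed.

Lemma lterm_dvd v w : w != 0 -> (lmon ltm w <= lmon ltm v)%MM ->
  exists a, lterm ltm v = a * lterm ltm w.
Proof.
move=> w0 wv; exists (lc ltm v / lc ltm w *: 'X_[lmon ltm v - lmon ltm w]).
rewrite /lterm -scalerAl -scalerAr scalerA -mulrA mulVf ?lc_neq0 // mulr1.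
by rewrite -mpolyXD submK.
Qed.

(** * Closure of pairs under the operations of the algorithm *)

Lemma is_pair_mval f t p : is_pair f p -> is_pair f (mval (t, p)).
Proof.
rewrite /is_pair /= => <-; rewrite mulr_sumr.
by apply: eq_bigr => i _; rewrite mxE mulrA.
Qed.

Lemma is_pair_top_reduce f p q :
  is_pair f p -> is_pair f q -> is_pair f (top_reduce ltm p q).
Proof.
rewrite /is_pair /= => <- <-; rewrite mulr_sumr -sumrB.
by apply: eq_bigr => i _; rewrite !mxE mulrBl mulrA.
Qed.

Lemma is_pair_top_reduces f p q :
  top_reduces ltm lts f p q -> is_pair f p -> is_pair f q.
Proof.
by elim=> // p' r _ IH rf _ pf; apply: is_pair_top_reduce => //; apply: IH.
Qed.

Lemma is_pair_initial f i : is_pair f (initial_pair f i).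
Proof.
rewrite /is_pair (bigD1 i) //= big1 ?addr0 => [|j ne].
  by rewrite mxE !eqxx mul1r.
by rewrite mxE (negPf ne) mul0r.
Qed.

(** * Existence of TRP and TRB pairs *)

Lemma sig_nonsyzygy f p : is_pair f p -> ~~ syzygy ltm p ->
  exists s, sig lts p = Some s.
Proof.
rewrite /syzygy /plm lm_eqNone /sig => pf; have := slmP p.1.
case: slm => [s _ _|u0]; first by exists s.
(* Without a signature all components of [p.1] vanish, hence so does [p.2], their combination with
   [f]. *)
move: pf; rewrite /is_pair => <- /eqP[]; apply: big1 => i _.
suff -> : p.1 0 i = 0 by rewrite mul0r.
apply/eqP; rewrite -msupp_eq0; case E: msupp => [//|m r].
by case: (u0 (m, i)); rewrite /= E mem_head.
Qed.

Lemma exists_TRP f p : is_pair f p -> ~~ syzygy ltm p ->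
  exists2 q, TRP ltm lts f q & plm ltm q = plm ltm p.
Proof.
move=> pf np; have [s0 ps0] := sig_nonsyzygy pf np.
pose P s := exists q, [/\ is_pair f q, plm ltm q = plm ltm p &
  sig lts q = Some s].
have /(admissible_has_min)[s [q [qf qp qs]] smin] : P s0 by exists p.
have nq : ~~ syzygy ltm q by rewrite /syzygy qp.
exists q => //; split=> // r rf; apply/negP => /and4P[_ nr qr rq].
have [s' rs'] := sig_nonsyzygy rf nr.
move: nq nr; rewrite /syzygy /plm !lm_eqNone => /lm_lmon qm /lm_lmon rm.
set a := lmon ltm q.2 in rq qm; set b := lmon ltm r.2 in rq rm.
(* The multiple of the reducer [r] that has the leading monomial of [q]; its signature undercuts the
   minimal [s]. *)
have /smin/negP[] : P (smul (a - b)%MM s').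
  exists (mval ((a - b)%MM, r)); split; first exact: is_pair_mval.
    by rewrite -qp /plm lmXM rm qm /= submK.
  by rewrite /sig slmXM -/(sig lts r) rs'.
(* After multiplication by [b] the comparison is between [smul a s'] and [smul b s], which is
   [ltp q r]. *)
apply: (@smul_cancel b); rewrite smulA addmC submK //.
by move: qr; rewrite /ltp /plm qm rm qs rs'.
Qed.

Lemma exists_TRB f p : TRP ltm lts f p ->
  exists2 q, TRB ltm lts f q & (lmon ltm q.2 <= lmon ltm p.2)%MM.
Proof.
have [k] := ubnP (mdeg (lmon ltm p.2)); elim: k p => // k IH p.
rewrite ltnS => ltpk Tp.
have [Bp|nB] := classic (TRB ltm lts f p); first by exists p; rewrite ?lepm_refl.
have [q [[Tq qp] [[t st] ne]]] : exists q, TRP_similar_set ltm lts f p q /\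
    (Defs.sdvd (sig lts q) (sig lts p) /\ sig lts q <> sig lts p).
  apply: NNPP => no; apply: nB; split=> // q Sq dq; apply: no; by exists q.
have [pf np _] := Tp; have [qf nq _] := Tq.
have [s qs] := sig_nonsyzygy qf nq.
move: np nq; rewrite /syzygy /plm !lm_eqNone => /lm_lmon pm /lm_lmon qm.
move: st ne qp; rewrite qs /= => ps; rewrite ps => ne.
rewrite /Defs.similar /plm pm qm qs ps /= /smul /= => /eqP sqp.
(* Similarity equates [lm q * t * s] with [lm p * s], and the monomial part of [s] cancels. The
   default in [odflt s] is never reached. *)
have {sqp} pq : (lmon ltm q.2 + t = lmon ltm p.2)%MM.
  move/(congr1 (fun o => (odflt s o).1)): sqp => /= /eqP.
  by rewrite addmA eqm_add2r => /eqP.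
(* A trivial [t] would make the two signatures equal, so the degree drops strictly. *)
have ltqp : (mdeg (lmon ltm q.2) < mdeg (lmon ltm p.2))%N.
  rewrite -pq mdegD -addn1 leq_add2l lt0n mdeg_eq0; apply/eqP => t0.
  by apply: ne; rewrite t0 /smul add0m -surjective_pairing.
have [r Br rq] := IH q (leq_trans ltqp ltpk) Tq.
exists r => //; apply: (lepm_trans rq).
by rewrite -pq; apply: lem_addr.
Qed.


Lemma reachable_is_pair (A : algorithm K n d) f st :
  TRB_algorithm ltm lts A -> reachable ltm lts A f st ->
  (forall w, w \in todo st -> is_pair f w.2) /\
  (forall p, p \in done st -> is_pair f p).
Proof.
move=> A_TRB; elim=> [|{}st w rst [todoP doneP] sel].
  by split=> // w /imfsetP[i _ ->]; apply: is_pair_initial.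
have [w_todo _] := sel; have wf := todoP _ w_todo.
have todo1P w' : w' \in todo st `\ w -> is_pair f w'.2.
  by rewrite in_fsetD1 => /andP[_ /todoP].
rewrite /process; case: ifPn => [_|/(A_TRB f st w rst sel)[red _ _]] //.
case: ifPn => // _; set p' := reductions _ _ _ _ in red *.
have p'f : is_pair f p'.
  by apply: is_pair_top_reduces red _; case: (w) wf => m p; apply: is_pair_mval.
split=> [w'|p] /=; last by rewrite in_fset1U => /orP[/eqP->|/doneP].
rewrite in_fsetU => /orP[/todo1P //|/imfsetP[q /=]].
rewrite inE => /andP[/doneP qf _] ->.
by rewrite /jpair; case: ifP.
Qed.

End Leading.
End AdmissibleOrders.

(** * Ideals generated by a set *)

Section IdealGen.
Variable R : comNzRingType.
Implicit Types (S : R -> Prop) (h : R).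

Lemma ideal_gen0 S : ideal_gen S 0.
Proof. by exists [::]; rewrite big_nil. Qed.

Lemma ideal_genD S h h' :
  ideal_gen S h -> ideal_gen S h' -> ideal_gen S (h + h').
Proof.
move=> [s [sS ->]] [s' [s'S ->]]; exists (s ++ s'); rewrite big_cat; split=> //.
by move=> x; rewrite mem_cat => /orP[/sS|/s'S].
Qed.

Lemma ideal_genM S a h : S h -> ideal_gen S (a * h).
Proof.
move=> Sh; exists [:: (a, h)]; rewrite big_seq1; split=> // x.
by rewrite inE => /eqP->.
Qed.

(** Elements of the first ideal are finite sums of multiples [a * t], and the second ideal is closed
    under sums. *)
Lemma sub_ideal_gen S S' h :
  (forall a t, S t -> ideal_gen S' (a * t)) -> ideal_gen S h -> ideal_gen S' h.
Proof.
move=> SS' [s [sS ->]]; elim: s sS => [|x s IHs] sS.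
  by rewrite big_nil; apply: ideal_gen0.
rewrite big_cons; apply: ideal_genD; first by apply/SS'/sS/mem_head.
by apply: IHs => y ys; apply: sS; rewrite inE ys orbT.
Qed.

End IdealGen.

(** * Ideal elements as second components of pairs *)

Section PairIdeal.
Variables (K : fieldType) (n d : nat) (f : 'rV[{mpoly K[n]}]_d).

Lemma ideal_of_pair p :
  is_pair f p -> ideal_gen (fun h => exists i : 'I_d, h = f 0 i) p.2.
Proof.
move=> <-; exists [seq (p.1 0 i, f 0 i) | i <- enum 'I_d]; split.
  by move=> x /mapP[i _ ->]; exists i.
by rewrite big_map big_enum.
Qed.

Lemma pair_of_ideal h :
  ideal_gen (fun h => exists i : 'I_d, h = f 0 i) h ->
  exists u, is_pair f (u, h).
Proof.
move=> [s [sS ->]]; elim: s sS => [|x s IHs] sS.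
  exists 0; rewrite /is_pair big_nil big1 // => i _.
  by rewrite mxE mul0r.
have [y ys|u uE] := IHs; first by apply: sS; rewrite inE ys orbT.
have [i xi] := sS x (mem_head _ _).
(* The summand [x.1 * f 0 i] is absorbed by adding [x.1] times the [i]-th unit vector. *)
exists (x.1 *: delta_mx 0 i + u)%R; rewrite /is_pair big_cons xi /=.
under eq_bigr do rewrite mxE mulrDl.
rewrite big_split; congr (_ + _)%R; last exact: uE.
rewrite (bigD1 i) //= big1 ?addr0 => [|j ne]; first by rewrite !mxE !eqxx mulr1.
by rewrite !mxE (negPf ne) andbF mulr0 mul0r.
Qed.

End PairIdeal.

(** * Comparison of the two leading term ideals *)

Theorem theorem2 (K : fieldType) (n d : nat)
    (ltm : rel 'X_{1..n}) (lts : rel (smon n d))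
    (ltm_adm : admissible_mon ltm) (lts_adm : admissible_smon lts)
    (A : algorithm K n d)
    (A_TRB : TRB_algorithm ltm lts A) (A_regular : regular ltm lts A)
    (f : 'rV[{mpoly K[n]}]_d) (st : state K n d)
    (A_stops : terminates_in ltm lts A f st) :
  groebner_basis ltm [fset p.2 | p in done st]
    (ideal_gen (fun h => exists i : 'I_d, h = f 0 i)).
Proof.
have [reach _] := A_stops.
have [_ doneP] := reachable_is_pair A_TRB reach.
have GI g : g \in [fset p.2 | p in done st] ->
    ideal_gen (fun h => exists i : 'I_d, h = f 0 i) g.
  by move=> /imfsetP[p /= /doneP pf ->]; apply: ideal_of_pair.
split=> // h; split; apply: sub_ideal_gen => a t [g].
  by move=> /GI gI ->; apply: ideal_genM; exists g.
move=> /pair_of_ideal[u uf] ->; have [->|g0] := eqVneq g 0.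
  by rewrite lterm0 mulr0; apply: ideal_gen0.
have [|p Tp pg] := exists_TRP ltm_adm lts_adm uf.
  by rewrite /syzygy /plm lm_eqNone.
have [q Bq qp] := exists_TRB ltm_adm lts_adm Tp.
have [r r_done /andP[_ /eqP qr]] := A_regular f st A_stops q Bq.
have r0 : r.2 != 0.
  rewrite -(lm_eqNone ltm_adm) -/(plm ltm r) -qr.
  by case: Bq => -[[]].
(* [lm r = lm q] divides [lm p = lm g], so [lterm g] is a multiple of [lterm r.2]. *)
have [|b ->] := @lterm_dvd _ _ ltm_adm K g r.2 r0.
  by move: qp; rewrite /lmon -/(plm ltm q) qr -/(plm ltm p) pg.
by rewrite mulrA; apply: ideal_genM; exists r.2 => //; apply: in_imfset.
Qed.
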